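(* Let $\gamma,\theta>0$ and let $P(t,x,\cdot)$ be the transition function of the process $SSS(\gamma,\theta)$ on $C$. 1. The $\tfrac12$-Bernoulli product measure $b=\mu^{\mathbb{N}}$ on $C=\{0,1\}^{\mathbb{N}}$, where $\mu(\{0\})=\mu(\{1\})=\tfrac12$, is the unique invariant (probability) measure for $SSS(\gamma,\theta)$. 2. There are constants $K,\nu>0$ such that for every $x\in C$ and every $t\ge0$, $$|P(t,x,\cdot)-b(\cdot)|_{TV}\le Ke^{-\nu t},$$ where $|\cdot|_{TV}$ denotes the total variation norm.
   Context: $C=\{0,1\}^{\mathbb{N}}$ (the triadic Cantor set, with $x=\sum_{k\ge1}2x_k3^{-k}$ identified with $(x_k)_{k\in\mathbb{N}}$), $\mathbb{N}=\{1,2,\dots\}$, with the ultrametric $d(x,y)=3^{-c(x,y)}$, $c(x,y)=\min\{k:x_k\ne y_k\}$, $d(x,x)=0$. For $n\in\mathbb{N}$: $L_n=\{0,1\}^n$, $\pi_nx=(x_1,\dots,x_n)$, and for $v\in L_n$, $x\in C$ with $\pi_nx\ne v$, $c(x,v)=\min\{k:x_k\ne v_k\}$. $\mathcal{C}(C)$ is the space of continuous real functions on $C$ with the sup norm. For $\gamma,\theta\ge0$, $SSS(\gamma,\theta)$ denotes the unique $C$-valued Feller Markov process (with càdlàg paths) whose generator on $\mathcal{C}(C)$ is the closure of the operator $A$ defined on cylindric functions $f=h\circ\pi_n$ ($n\in\mathbb{N}$, $h:L_n\to\mathbb{R}$) by $$Af(x)=\gamma\sum_{k=1}^n\theta^k\bigl(\langle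 h\rangle_{n,k,x}-h(\pi_nx)\bigr),\qquad \langle h\rangle_{n,k,x}=2^{-(n-k)}\sum_{v\in L_n:\,c(x,v)=k}h(v).$$ (The closure of $A$ is a Markov generator, so that this process exists and is unique in law for each starting point.) *)

(* Defs.v *)
From HB Require Import structures.
From mathcomp Require Import all_boot all_order all_algebra.
From mathcomp Require Import all_classical all_reals all_analysis.
(* Needed after all_analysis for \bar R to be inferred as a measurableType. *)
From mathcomp Require Import measurable_realfun.
From mathcomp Require Import lra.
Set Implicit Arguments.
Unset Strict Implicit.
Unset Printing Implicit Defensive.
Import Order.TTheory GRing.Theory Num.Theory.
Import numFieldNormedType.Exports.
Local Open Scope classical_set_scope.
Local Open Scope ring_scope.

(* The sequence space {0,1}^N is cantor_space = nat -> bool with the product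
   topology, which is the topology of the ultrametric 3^-c(x, y); the coordinate
   x_k (k >= 1) is x k.-1.  It carries its Borel sigma-algebra. *)
HB.instance Definition _ :=
  Measurable.copy cantor_space (g_sigma_algebraType (@open cantor_space)).

Definition proj_level (n : nat) (x : cantor_space) : n.-tuple bool :=
  [tuple x i | i < n].

(* c(x, v), counted from 1; the value is n.+1 when v = proj_level n x. *)
Definition first_difference (n : nat) (x : cantor_space) (v : n.-tuple bool) : nat :=
  (find (fun i => x i != nth false v i) (iota 0 n)).+1.

(* <h>_{n,k,x} for 1 <= k <= n: there are 2 ^ (n - k) words v with c(x, v) = k. *)
Definition level_average (R : realType) (n k : nat) (h : n.-tuple bool -> R)
    (x : cantor_space) : R :=
  (2 ^+ (n - k))^-1 * \sum_(v : n.-tuple bool | first_difference x v == k) h v.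

Definition cylindric_operator (R : realType) (gamma theta : R) (n : nat)
    (h : n.-tuple bool -> R) (x : cantor_space) : R :=
  gamma * \sum_(1 <= k < n.+1)
    theta ^+ k * (level_average k h x - h (proj_level n x)).

(* An operator on C(cantor_space) is represented by its graph, a set of pairs of
   functions, the function space having the topology of uniform convergence. *)
Definition operator_graph (R : realType) : Type :=
  set ({uniform cantor_space -> R} * {uniform cantor_space -> R}).

Definition pregenerator (R : realType) (gamma theta : R) : operator_graph R :=
  [set fg | exists n (h : n.-tuple bool -> R), [/\ (0 < n)%N,
     fg.1 = (fun x : cantor_space => h (proj_level n x)) &
     fg.2 = cylindric_operator gamma theta h]].

Definition semigroup (R : realType)
    (P : R -> cantor_space -> probability cantor_space R)
    (t : R) (f : cantor_space -> R) : cantor_space -> R :=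
  fun x => \int[P t x]_y f y.

(* Time is the half-line [0, +oo[: the values of P at t < 0 are irrelevant. *)
Record feller_transition_function (R : realType)
    (P : R -> cantor_space -> probability cantor_space R) : Prop := {
  measurable_transition : forall (t : R) (B : set cantor_space), 0 <= t ->
    measurable B -> measurable_fun [set: cantor_space] (P t ^~ B) ;
  transition0 : forall x (B : set cantor_space), measurable B ->
    P 0 x B = \d_x B ;
  chapman_kolmogorov : forall (s t : R) x (B : set cantor_space),
    0 <= s -> 0 <= t -> measurable B ->
    P (s + t) x B = (\int[P s x]_y P t y B)%E ;
  feller_continuous : forall (t : R) (f : cantor_space -> R), 0 <= t ->
    continuous f -> continuous (semigroup P t f) ;
  feller_cvg0 : forall f : cantor_space -> R, continuous f ->
    {uniform, (fun t : R => semigroup P t f) @ 0^'+ --> f} }.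

Definition generator (R : realType)
    (P : R -> cantor_space -> probability cantor_space R) : operator_graph R :=
  [set fg | [/\ continuous (fg.1 : cantor_space -> R),
     continuous (fg.2 : cantor_space -> R) &
     {uniform, (fun (t : R) x => t^-1 * (semigroup P t fg.1 x - fg.1 x)) @ 0^'+
       --> (fg.2 : cantor_space -> R)}]].

Definition natural_filtration (R : realType) (d : measure_display)
    (W : measurableType d) (X : R -> W -> cantor_space) (s : R) : set (set W) :=
  <<s \bigcup_(u in [set u : R | 0 <= u <= s])
        preimage_set_system setT (X u) measurable >>.

(* Pr x is the law of the process started at x. *)
Record markov_process (R : realType) (d : measure_display)
    (W : measurableType d) (Pr : cantor_space -> probability W R)
    (X : R -> W -> cantor_space)
    (P : R -> cantor_space -> probability cantor_space R) : Prop := {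
  process_measurable : forall t : R, 0 <= t -> measurable_fun setT (X t) ;
  process_start : forall x, Pr x [set w | X 0 w = x] = 1%E ;
  markov_property : forall x (s t : R) (F : set W) (B : set cantor_space),
    0 <= s -> 0 <= t -> natural_filtration X s F -> measurable B ->
    Pr x (F `&` X (s + t) @^-1` B) = (\int[Pr x]_(w in F) P t (X s w) B)%E }.

Definition cadlag (R : realType) (T : topologicalType) (f : R -> T) : Prop :=
  (forall t : R, 0 <= t -> f @ t^'+ --> f t) /\
  (forall t : R, 0 < t -> exists l : T, f @ t^'- --> l).

Record SSS (R : realType) (gamma theta : R) (d : measure_display)
    (W : measurableType d) (Pr : cantor_space -> probability W R)
    (X : R -> W -> cantor_space)
    (P : R -> cantor_space -> probability cantor_space R) : Prop := {
  SSS_markov : markov_process Pr X P ;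
  SSS_cadlag : forall w, cadlag (X ^~ w) ;
  SSS_feller : feller_transition_function P ;
  SSS_generator : generator P = closure (pregenerator gamma theta) }.

Definition invariant_measure (R : realType)
    (P : R -> cantor_space -> probability cantor_space R)
    (m : probability cantor_space R) : Prop :=
  forall (t : R) (B : set cantor_space), 0 <= t -> measurable B ->
    (\int[m]_x P t x B)%E = m B.

Definition charge_diff (R : realType) (d : measure_display)
    (T : measurableType d) (m1 m2 : {finite_measure set T -> \bar R}) :
    {charge set T -> \bar R} :=
  cadd (charge_of_finite_measure m1)
       (cscale (-1) (charge_of_finite_measure m2)).

(* Total mass of the variation of nu, computed from some Hahn decomposition
   (all of them give the same value). *)
Definition tv_norm (R : realType) (d : measure_display) (T : measurableType d)
    (nu : {charge set T -> \bar R}) : \bar R :=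
  charge_variation (projT2 (cid (projT2 (cid (Hahn_decomposition nu))))) setT.

Definition is_product_measure (R : realType) (mu : probability bool R)
    (b : probability cantor_space R) : Prop :=
  forall (n : nat) (A : 'I_n -> set bool),
    b [set x : cantor_space | forall i : 'I_n, A i (x i)] =
    (\prod_(i < n) mu (A i))%E.

Definition half_bernoulli (R : realType) : probability bool R :=
  bernoulli_prob (2^-1).

(* Existence: push Lebesgue measure on [0, 1[ forward by the binary digits. *)
Section product_measure_exists.
Variable R : realType.

Lemma cylinder_nbhs (x : cantor_space) (U : set cantor_space) : open U -> U x ->
  exists n, [set y : cantor_space | forall i, (i < n)%N -> y i = x i] `<=` U.
Proof.
move=> oU Ux; apply: contrapT => /forallNP H.
have /choice[y Hy] : forall n, exists y : cantor_space,
    (forall i, (i < n)%N -> y i = x i) /\ ~ U y.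
  move=> n; have /existsNP[y /not_implyP[? ?]] := H n.
  by exists y.
have : {ptws, y @ \oo --> x}.
  apply/pointwise_cvgP => t.
  apply: cvg_near_cst; exists t.+1 => // n /= tn.
  by have [-> ] := Hy n.
move=> /(_ U); case.
  exact: open_nbhs_nbhs.
by move=> N _ /(_ N (leqnn N)) /=; case: (Hy N).
Qed.

Definition cyl (s : seq bool) : set cantor_space :=
  [set y | forall i, (i < size s)%N -> y i = nth false s i].

Lemma open_bigcup_cyl (U : set cantor_space) : open U ->
  U = \bigcup_(s in [set s | cyl s `<=` U]) cyl s.
Proof.
move=> oU; apply/seteqP; split => x; last by case=> s /= sU; exact: sU.
move=> Ux; have [n nU] := cylinder_nbhs oU Ux; exists (mkseq x n).
  move=> y; rewrite /cyl /= size_mkseq => Hy; apply: nU => i /= ni.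
  by rewrite Hy// nth_mkseq.
by move=> i; rewrite size_mkseq => ni; rewrite nth_mkseq.
Qed.

Definition digits (r : R) : cantor_space := fun k => odd (Num.truncn (2 ^+ k.+1 * r)).

Fixpoint word_val (v : nat -> bool) n : nat :=
  if n is n'.+1 then (v n' + (word_val v n').*2)%N else 0%N.

Lemma digitsP (v : nat -> bool) n r : 0 <= r -> r < 1 ->
  (forall i, (i < n)%N -> digits r i = v i) <->
  Num.truncn (2 ^+ n * r) = word_val v n.
Proof.
move=> r0 r1; elim: n => [|n IH] /=.
  split=> // _; rewrite expr0 mul1r; apply/eqP.
  by rewrite truncn_eq// r0.
have half : ((Num.truncn (2 ^+ n.+1 * r))./2 = Num.truncn (2 ^+ n * r))%N.
  apply/esym/eqP; rewrite truncn_eq ?mulr_ge0 ?exprn_ge0//.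
  set N := Num.truncn (2 ^+ n.+1 * r).
  have : N%:R <= 2 ^+ n.+1 * r < N.+1%:R.
    by apply: truncn_itv; rewrite mulr_ge0 ?exprn_ge0.
  rewrite exprS -mulrA; have := odd_double_half N.
  move: (2 ^+ n * r) N => z N {1 2}<- /andP[h1 h2].
  rewrite -(@ler_pM2l _ 2)// -(@ltr_pM2l _ 2 _ z)// -!natrM; apply/andP; split.
    by apply: le_trans h1; rewrite ler_nat mul2n leq_addl.
  apply: lt_le_trans h2 _; rewrite ler_nat mul2n doubleS.
  by case: (odd N).
split => [H|H].
  rewrite -(odd_double_half (Num.truncn _)) half.
  by rewrite (proj1 IH) => [|i ni]; [rewrite -H|apply: H; rewrite ltnS ltnW].
have E1 : digits r n = v n.
  by rewrite /digits H oddD odd_double addbF oddb.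
move=> i; rewrite ltnS leq_eqVlt => /predU1P[->//|].
apply: (proj2 IH); rewrite -half H.
by rewrite halfD odd_double andbF add0n doubleK; case: (v n).
Qed.

Lemma word_val_lt v n : (word_val v n < 2 ^ n)%N.
Proof.
elim: n => //= n; rewrite expnS mul2n -(@leq_double _.+1) doubleS => IH.
by apply: leq_trans IH; case: (v n).
Qed.

Lemma digits_itv (v : nat -> bool) n :
  [set r | forall i, (i < n)%N -> digits r i = v i] `&` `[0, 1[%classic =
  `[(word_val v n)%:R / 2 ^+ n, (word_val v n).+1%:R / 2 ^+ n[%classic.
Proof.
have n0 : 0 < 2 ^+ n :> R by rewrite exprn_gt0.
apply/seteqP; split => r /=; rewrite !in_itv/=.
  move=> [H /andP[r0 r1]]; move/(digitsP _ _ r0 r1)/eqP : H.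
  rewrite truncn_eq ?mulr_ge0 ?(ltW n0)// => /andP[h1 h2].
  by rewrite ler_pdivrMr// ltr_pdivlMr// mulrC h1 h2.
rewrite ler_pdivrMr// ltr_pdivlMr// mulrC => /andP[h1 h2].
have r0 : 0 <= r by rewrite -(pmulr_rge0 _ n0) (le_trans _ h1).
have r1 : r < 1.
  rewrite -(@ltr_pM2l _ (2 ^+ n))// mulr1 (lt_le_trans h2)//.
  by rewrite -natrX ler_nat word_val_lt.
split; last by rewrite r0.
by apply/(digitsP _ _ r0 r1)/eqP; rewrite truncn_eq ?h1 ?h2// mulr_ge0// ltW.
Qed.

Lemma measurable_digit k : measurable [set r : R | digits r k].
Proof.
rewrite (_ : [set r | _] = \bigcup_(m in [set m | odd m])
    `[m%:R / 2 ^+ k.+1, m.+1%:R / 2 ^+ k.+1[%classic).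
  by apply: bigcup_measurable => m _; exact: measurable_itv.
have n0 : 0 < 2 ^+ k.+1 :> R by rewrite exprn_gt0.
apply/seteqP; split => r /=.
  rewrite /digits => H; exists (Num.truncn (2 ^+ k.+1 * r)) => //=.
  rewrite in_itv/= ler_pdivrMr// ltr_pdivlMr// mulrC; apply: truncn_itv.
  rewrite leNgt; apply/negP => lt0; move: H.
  have -> : Num.truncn (2 ^+ k.+1 * r) = 0%N by apply/truncn0Pn; rewrite -ltNge mulrC (lt_trans lt0).
  by [].
move=> [m om] /=; rewrite in_itv/= ler_pdivrMr// ltr_pdivlMr// mulrC => H.
by rewrite /digits (@truncn_def _ _ m).
Qed.

Lemma measurable_digits : measurable_fun setT digits.
Proof.
apply: (@measurability _ _ _ _ _ _ (@open cantor_space)) => // _ [U oU <-].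
rewrite setTI (open_bigcup_cyl oU) preimage_bigcup bigcup_mkcond.
apply: countable_bigcupT_measurable; first exact: countableP.
move=> s; case: ifPn => // _.
rewrite (_ : _ @^-1` _ = \bigcap_(i in `I_(size s)) [set r | digits r i = nth false s i]).
  apply: fin_bigcap_measurable => [|i _]; first exact: finite_II.
  case: (nth false s i); first exact: measurable_digit.
  rewrite (_ : [set r | _] = ~` [set r | digits r i]).
    by apply: measurableC; exact: measurable_digit.
  by apply/seteqP; split => r /=; [move=> ->|move/negP/negbTE].
by [].
Qed.


Definition unit_lebesgue : set (measurableTypeR R) -> \bar R :=
  mrestr (@lebesgue_measure R)
    (measurable_itv `[0, 1[ : measurable (`[0, 1[%classic : set (measurableTypeR R))).

HB.instance Definition _ := Measure.on unit_lebesgue.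

Let unit_lebesgueT : unit_lebesgue setT = 1%E.
Proof.
by rewrite /unit_lebesgue /mrestr setTI lebesgue_measure_itv/= lte_fin ltr01 oppr0 adde0.
Qed.

HB.instance Definition _ := Measure_isProbability.Build _ _ _ unit_lebesgue unit_lebesgueT.

Definition rdigits : measurableTypeR R -> cantor_space := digits.

HB.instance Definition _ :=
  isMeasurableFun.Build _ _ _ _ rdigits measurable_digits.

Definition binary_measure : probability cantor_space R :=
  distribution unit_lebesgue
    rdigits.

Lemma binary_cyl n (v : 'I_n -> bool) :
  binary_measure [set x : cantor_space | forall i : 'I_n, x i = v i] = (2 ^- n)%:E.
Proof.
rewrite /binary_measure/= /distribution /pushforward /unit_lebesgue/= /mrestr.
pose w k := if insub k is Some i then v i else false.
rewrite (_ : _ @^-1` _ = [set r | forall i, (i < n)%N -> digits r i = w i]).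
  rewrite digits_itv lebesgue_measure_itv/= lte_fin ltr_pM2r ?invr_gt0 ?exprn_gt0//.
  by rewrite ltr_nat ltnSn -EFinB -mulrBl -natrB// subSnn mul1r.
apply/seteqP; split => r /= H i.
  by move=> ni; rewrite /w insubT; exact: (H (Ordinal ni)).
by rewrite [LHS]H// /w valK.
Qed.

Lemma measurable_cyl n (v : 'I_n -> bool) :
  measurable [set x : cantor_space | forall i : 'I_n, x i = v i].
Proof.
rewrite (_ : [set x | _] =
    \bigcap_(i in [set: 'I_n]) (@proj nat (fun=> bool) i @^-1` [set v i])).
  apply: fin_bigcap_measurable => // i _; apply: sub_sigma_algebra; apply: open_comp.
    by move=> x _; exact: proj_continuous.
  exact: discrete_open.
by apply/seteqP; split => [y yv i _|y yv i]; [exact: yv|exact: yv].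
Qed.

Lemma half_bernoulliE (A : set bool) : half_bernoulli R A =
  (\sum_(c : bool) if c \in A then 2^-1 else 0)%:E.
Proof.
have -> : half_bernoulli R A = ((2^-1)%:E * \d_true A + (1 - 2^-1)%:E * \d_false A)%E.
  by apply: bernoulli_probE; lra.
rewrite big_bool/= !diracE.
by case: (true \in A); case: (false \in A);
  rewrite /= ?mule1 ?mule0 ?add0e ?adde0// -?EFinD; congr (_%:E); lra.
Qed.

Lemma binary_product : is_product_measure (half_bernoulli R) binary_measure.
Proof.
move=> n A.
under [in RHS]eq_bigr do rewrite half_bernoulliE.
rewrite prodEFin bigA_distr_bigA/=.
pose F (f : {ffun 'I_n -> bool}) : set cantor_space :=
  if [forall i, f i \in A i] then [set x : cantor_space | forall i : 'I_n, x i = f i] else set0.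
have AF : [set x : cantor_space | forall i : 'I_n, A i (x i)] =
    \bigcup_(f in [set: {ffun 'I_n -> bool}]) F f.
  apply/seteqP; split => x /=; last first.
    by move=> [f _]; rewrite /F; case: ifPn => // /forallP Af xf i; rewrite xf; exact/set_mem/Af.
  move=> Ax; exists [ffun i : 'I_n => x i] => //; rewrite /F ifT.
    by move=> i; rewrite ffunE.
  by apply/forallP => i; rewrite ffunE inE.
transitivity (binary_measure (\bigcup_(f in [set: {ffun 'I_n -> bool}]) F f)).
  by congr (binary_measure _).
rewrite measure_fin_bigcup; last 3 first.
- exact: finite_finset.
- apply/trivIsetP => f g _ _ fg; apply/seteqP; split => // x [].
  rewrite /F; case: ifP => // _; case: ifP => //= _ xf xg.
  by move/eqP: fg; case; apply/ffunP => i; rewrite -xf -xg.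
- by move=> f _; rewrite /F; case: ifPn => _; [exact: measurable_cyl|exact: measurable0].
rewrite (@fsbigE _ _ _ _ [set: _] (index_enum {ffun 'I_n -> bool}))//=; last 2 first.
- exact: index_enum_uniq.
- by move=> f _; rewrite mem_index_enum.
rewrite -sumEFin big_mkcond; apply: eq_bigr => f _.
rewrite in_setT /F; case: ifPn => [/forallP Af|].
  transitivity ((2 ^- n : R)%:E); first exact: binary_cyl.
  rewrite (eq_bigr (fun=> 2^-1)) => [|i _]; last by rewrite Af.
  by rewrite prodr_const card_ord exprVn.
rewrite negb_forall => /existsP[i /negbTE Afi].
by rewrite measure0 (bigD1 i)//= Afi mul0r.
Qed.

End product_measure_exists.

Lemma half_product_measure_exists (R : realType) :
  exists b, is_product_measure (half_bernoulli R) b.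
Proof. by exists (binary_measure R); exact: binary_product. Qed.

Definition bernoulli_measure (R : realType) : probability cantor_space R :=
  projT1 (cid (half_product_measure_exists R)).

Lemma bernoulli_measureP (R : realType) :
  is_product_measure (half_bernoulli R) (bernoulli_measure R).
Proof. exact: projT2 (cid (half_product_measure_exists R)). Qed.

(* Main.v *)
(* Call f odd at level n when it depends on the first n+1 coordinates only and changes sign
   when the last of them is flipped.  Averaging over a level k <= n kills such an f, and level
   n+1 only flips the last coordinate, so A f = - r_n f with
   r_n = gamma (2 theta^(n+1) + sum_(1 <= k <= n) theta^k), and hence P_t f = exp(- r_n t) f.
   For a cylindric set B, the increments of the martingale F_m = b(B | first m coordinates)
   are odd, whence
     P(t, x, B) - b(B) = sum_m exp(- r_m t) (F_(m+1)(x) - F_m(x)).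
   Since r_(m+1) - r_m = gamma theta^(m+1) (2 theta - 1) has a constant sign and
   r_m >= gamma theta, summation by parts bounds this by exp(- gamma theta t), uniformly in x
   and B; the bound passes to Borel sets by approximation.  Invariance holds because odd
   functions have mean zero under b, and uniqueness follows from the uniform bound. *)
Require Import Defs.
From mathcomp Require Import all_boot all_order all_algebra.
From mathcomp Require Import all_classical all_reals all_analysis.
From mathcomp Require Import measurable_realfun.
From mathcomp Require Import ring lra.
Import Order.TTheory GRing.Theory Num.Theory.
Import numFieldNormedType.Exports.
Local Open Scope classical_set_scope.
Local Open Scope ring_scope.

Set Implicit Arguments.
Unset Strict Implicit.
Unset Printing Implicit Defensive.

(** * Functions of finitely many coordinates *)

(** The type [T] may be [Prop], so cylindric sets and cylindric functions fall under one notion. *)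
Definition depends_on (T : Type) (n : nat) (f : cantor_space -> T) : Prop :=
  forall x y : cantor_space, (forall i, (i < n)%N -> x i = y i) -> f x = f y.

(** The padding by [false] merely selects a point of the cylinder of [w]; a function with
    [depends_on n f] does not see this choice. *)
Definition extend (n : nat) (w : n.-tuple bool) : cantor_space := nth false w.

Definition cylinder (n : nat) (w : n.-tuple bool) : set cantor_space :=
  [set x | proj_level n x = w].

Lemma extend_proj_level n (x : cantor_space) i :
  (i < n)%N -> extend (proj_level n x) i = x i.
Proof.
by move=> ni; rewrite /extend (nth_map (Ordinal ni)) ?size_enum_ord// nth_enum_ord.
Qed.

Lemma proj_level_extend n (w : n.-tuple bool) : proj_level n (extend w) = w.
Proof.
by apply: eq_from_tnth => i; rewrite tnth_mktuple /extend (tnth_nth false).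
Qed.

Lemma eq_proj_level n (x y : cantor_space) :
  (forall i, (i < n)%N -> x i = y i) <-> proj_level n x = proj_level n y.
Proof.
split=> [xy|xy i ni].
  by apply: eq_from_tnth => i; rewrite !tnth_mktuple; exact: xy.
by rewrite -(extend_proj_level x ni) xy extend_proj_level.
Qed.

Lemma depends_onE T n (f : cantor_space -> T) x : depends_on n f ->
  f (extend (proj_level n x)) = f x.
Proof. by apply => i ni; exact: extend_proj_level. Qed.

Lemma depends_on_le T m n (f : cantor_space -> T) : (m <= n)%N ->
  depends_on m f -> depends_on n f.
Proof. by move=> mn mf x y xy; apply: mf => i im; apply/xy/(leq_trans im). Qed.

Lemma depends_on_cylinder n (w : n.-tuple bool) : depends_on n (cylinder w).
Proof. by move=> x y /eq_proj_level xy; rewrite /cylinder/= xy. Qed.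

Lemma measurable_cylinder n (w : n.-tuple bool) : measurable (cylinder w).
Proof.
rewrite (_ : cylinder w = [set x : cantor_space | forall i : 'I_n, x i = tnth w i]).
  exact: measurable_cyl.
apply/seteqP; split => x /=.
  by move=> <- i; rewrite tnth_mktuple.
by move=> xw; apply: eq_from_tnth => i; rewrite tnth_mktuple.
Qed.

Lemma measurable_depends_on n (B : set cantor_space) :
  depends_on n B -> measurable B.
Proof.
move=> nB; rewrite (_ : B = \bigcup_(w in [set w : n.-tuple bool | B (extend w)]) cylinder w).
  apply: fin_bigcup_measurable => [|w _]; first exact: finite_finset.
  exact: measurable_cylinder.
apply/seteqP; split => [x Bx|x [w /= Bw xw]].
  by exists (proj_level n x) => //=; rewrite depends_onE.
by rewrite -(depends_onE x nB) (xw : proj_level n x = w).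
Qed.

Lemma measurable_fun_depends_on d (T : measurableType d) n (f : cantor_space -> T) :
  depends_on n f -> measurable_fun setT f.
Proof.
move=> nf _ B mB; rewrite setTI; apply: (@measurable_depends_on n) => x y xy.
by rewrite /preimage/= (nf _ _ xy).
Qed.

(** An open set is the union of the cylinders it contains, and there are only countably many finite
    words. Together with closure under intersection this prepares Dynkin induction from cylindric
    sets. *)
Lemma measurable_cantorE :
  @measurable _ cantor_space = <<s [set B | exists n, depends_on n B] >>.
Proof.
apply/seteqP; split => [B|]; last first.
  apply: smallest_sub; first exact: sigma_algebra_measurable.
  by move=> B [n nB]; exact: measurable_depends_on nB.
apply: smallest_sub; first exact: smallest_sigma_algebra.
move=> U /= oU; rewrite (open_bigcup_cyl oU) bigcup_mkcond.
apply: (@countable_bigcupT_measurable _ (g_sigma_algebraType [set B | exists n, depends_on n B])).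
  exact: countableP.
move=> s; case: ifPn => _; last exact: measurable0.
apply: sub_sigma_algebra; exists (size s) => x y xy.
by apply/propext; rewrite /cyl/=; split => sx i si; rewrite -sx// xy.
Qed.

Lemma setI_closed_depends_on :
  setI_closed [set B : set cantor_space | exists n, depends_on n B].
Proof.
move=> A B [m mA] [n nB]; exists (maxn m n) => x y xy.
rewrite /setI/= (depends_on_le (leq_maxl m n) mA xy).
by rewrite (depends_on_le (leq_maxr m n) nB xy).
Qed.

(** * Integrals of cylindric functions as finite sums *)

Section integration.
Variable R : realType.
Implicit Types (mu : probability cantor_space R) (f : cantor_space -> R).

Lemma bounded_depends_on n f : depends_on n f -> exists M : R, forall x, `|f x| <= M.
Proof.
move=> nf; exists (\sum_(w : n.-tuple bool) `|f (extend w)|) => x.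
rewrite -(depends_onE x nf) (bigD1 (proj_level n x))//= lerDl.
by apply: sumr_ge0.
Qed.

Lemma depends_on_indic n (B : set cantor_space) :
  depends_on n B -> depends_on n (\1_B : cantor_space -> R).
Proof.
move=> nB x y /nB xy; rewrite !indicE; congr (_%:R).
by apply: congr1; apply/idP/idP; rewrite !inE xy.
Qed.

Lemma integrable_bounded mu f M : measurable_fun setT f ->
  (forall x, `|f x| <= M) -> mu.-integrable setT (EFin \o f).
Proof.
move=> mf fM; apply: measurable_bounded_integrable => //.
  by rewrite (le_lt_trans (probability_le1 _ _))// ltry.
by exists M; split; [exact: num_real|move=> N MN x _; apply: le_trans (ltW MN)].
Qed.

Lemma integrable_depends_on mu n f : depends_on n f ->
  mu.-integrable setT (EFin \o f).
Proof.
move=> nf; have [M fM] := bounded_depends_on nf.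
by apply: integrable_bounded fM; exact: measurable_fun_depends_on nf.
Qed.

Lemma Rintegral_cst_probability mu (c : R) : \int[mu]_x c = c.
Proof. by rewrite Rintegral_cst//= (@probability_setT _ _ _ mu) mulr1. Qed.

Lemma le_normr_Rintegral_probability mu f c : measurable_fun setT f ->
  (forall x, `|f x| <= c) -> `|\int[mu]_x f x| <= c.
Proof.
move=> mf fc; have intf := integrable_bounded mu mf fc.
apply: le_trans (le_normr_Rintegral measurableT intf) _.
rewrite -[leRHS](Rintegral_cst_probability mu).
apply: le_Rintegral => //=; last by exact: finite_measure_integrable_cst.
by apply: (@integrable_bounded _ _ c) => [|x]; [exact: measurableT_comp|rewrite normr_id].
Qed.

Lemma Rintegral_sum_probability mu (I : Type) (s : seq I) (f : I -> cantor_space -> R) :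
  (forall i, mu.-integrable setT (EFin \o f i)) ->
  \int[mu]_x (\sum_(i <- s) f i x) = \sum_(i <- s) \int[mu]_x f i x.
Proof.
move=> intf; elim: s => [|i s IH].
  rewrite big_nil -[RHS](mul0r (fine (mu setT))) -Rintegral_cst//.
  by apply: eq_Rintegral => x _; rewrite big_nil.
rewrite big_cons -IH -RintegralD//.
  by apply: eq_Rintegral => x _; rewrite big_cons.
rewrite (_ : EFin \o _ = fun x => (\sum_(i <- s) (f i x)%:E)%E).
  by apply: (integrable_sum measurableT) => j _; exact: intf.
by apply/funext => x /=; rewrite sumEFin.
Qed.

(** A cylindric function is a finite linear combination of indicators of cylinders. *)
Lemma Rintegral_depends_on mu n f : depends_on n f ->
  \int[mu]_x f x = \sum_(w : n.-tuple bool) f (extend w) * fine (mu (cylinder w)).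
Proof.
move=> nf; pose g (w : n.-tuple bool) x : R := f (extend w) * \1_(cylinder w) x.
have intI w : mu.-integrable setT (EFin \o (\1_(@cylinder n w) : cantor_space -> R)).
  by apply: integrable_indic; exact: measurable_cylinder.
transitivity (\int[mu]_x \sum_(w : n.-tuple bool) g w x).
  apply: eq_Rintegral => x _; rewrite (bigD1 (proj_level n x))//= big1 => [|w wx].
    by rewrite addr0 /g indicE mem_set//= mulr1 depends_onE.
  by rewrite /g indicE memNset ?mulr0//= => xw; rewrite -xw eqxx in wx.
rewrite Rintegral_sum_probability => [|w].
  apply: eq_bigr => w _; rewrite /g RintegralZl//; congr (_ * _).
  by rewrite /Rintegral integral_indic ?setIT//; exact: measurable_cylinder.
apply: (@integrable_depends_on _ n) => x y xy.
by rewrite /g (depends_on_indic (@depends_on_cylinder n w) xy).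
Qed.

Lemma Rintegral_indic mu (B : set cantor_space) : measurable B ->
  \int[mu]_x \1_B x = fine (mu B).
Proof. by move=> mB; rewrite /Rintegral integral_indic ?setIT. Qed.

Lemma measurable_Rintegral (Q : cantor_space -> probability cantor_space R) n f :
  (forall B, measurable B -> measurable_fun setT (Q ^~ B)) -> depends_on n f ->
  measurable_fun setT (fun x => \int[Q x]_y f y).
Proof.
move=> mQ nf; under eq_fun do rewrite (Rintegral_depends_on _ nf).
apply: measurable_sum => w; apply: measurable_funM => //.
by apply: measurableT_comp => //; apply: mQ; exact: measurable_cylinder.
Qed.

(** Carries an identity between measures, such as Chapman-Kolmogorov, over to cylindric integrands:
    expanding over words leaves a finite sum of instances of the identity on cylinders. *)
Lemma Rintegral_mixture mu (nu : probability cantor_space R) (Q : cantor_space -> probability cantor_space R) n f :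
  (forall B, measurable B -> measurable_fun setT (Q ^~ B)) ->
  (forall B, measurable B -> nu B = (\int[mu]_x Q x B)%E) -> depends_on n f ->
  \int[nu]_y f y = \int[mu]_x \int[Q x]_y f y.
Proof.
move=> mQ nuE nf; rewrite (Rintegral_depends_on nu nf).
under [RHS]eq_Rintegral do rewrite (Rintegral_depends_on _ nf).
have intQ w : mu.-integrable setT (EFin \o (fun x => fine (Q x (@cylinder n w)))).
  apply: (@integrable_bounded _ _ 1) => [|x].
    by apply: measurableT_comp => //; apply: mQ; exact: measurable_cylinder.
  have mw := @measurable_cylinder n w.
  by rewrite ger0_norm ?fine_ge0// -lee_fin fineK ?fin_num_measure ?probability_le1.
rewrite Rintegral_sum_probability => [|w]; last first.
  have /= := integrableZl measurableT (f (extend w)) (intQ w).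
  by congr (integrable _ _ _); apply/funext => x; rewrite /= EFinM.
apply: eq_bigr => w _; rewrite RintegralZl//; congr (_ * _).
have mw := @measurable_cylinder n w.
rewrite nuE// /Rintegral; congr fine; apply: eq_integral => x _.
by rewrite fineK// fin_num_measure.
Qed.

End integration.

(** * Eigenfunctions of the generator *)

Definition flip (n : nat) (x : cantor_space) : cantor_space :=
  fun i => if i == n then ~~ x i else x i.

Definition flip_word (n : nat) (w : n.+1.-tuple bool) : n.+1.-tuple bool :=
  proj_level n.+1 (flip n (extend w)).

Lemma nth_flip_word n (w : n.+1.-tuple bool) i : (i < n.+1)%N ->
  nth false (flip_word w) i = if i == n then ~~ nth false w i else nth false w i.
Proof. exact: extend_proj_level. Qed.

Lemma flip_wordK n : involutive (@flip_word n).
Proof.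
move=> w; apply: eq_from_tnth => i; rewrite !(tnth_nth false).
by rewrite !nth_flip_word//; case: eqP => // _; rewrite negbK.
Qed.

Lemma iota0S n : iota 0 n.+1 = iota 0 n ++ [:: n].
Proof. by rewrite -addn1 iotaD. Qed.

(** Either the first mismatch occurs among the first [n] coordinates, where [v] and [w] agree, or
    both values exceed [n]. Hence every level [k <= n] is stable under flipping the last letter. *)
Lemma first_difference_prefix n (x : cantor_space) (v w : n.+1.-tuple bool) k :
  (forall i, (i < n)%N -> nth false v i = nth false w i) -> (k <= n)%N ->
  (first_difference x v == k) = (first_difference x w == k).
Proof.
move=> vw kn; rewrite /first_difference iota0S !find_cat.
have E : {in iota 0 n, (fun i => x i != nth false v i) =1 (fun i => x i != nth false w i)}.
  by move=> i; rewrite mem_iota => /andP[_ /vw ->].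
rewrite (eq_in_has E) (eq_in_find E); case: ifP => // _.
by rewrite size_iota !gtn_eqF// ltnS (leq_trans kn)// leq_addr.
Qed.

(** Over the alphabet [bool], a word that differs from [x] only at its last letter is determined, so
    the top level is a single word. *)
Lemma first_difference_last n (x : cantor_space) (v : n.+1.-tuple bool) :
  (first_difference x v == n.+1) = (v == proj_level n.+1 (flip n x)).
Proof.
rewrite /first_difference eqSS iota0S find_cat/= size_iota.
case: ifPn => [xv|/hasPn xv].
  have : (find (fun i => x i != nth false v i) (iota 0 n) < n)%N.
    by move: xv; rewrite has_find size_iota.
  move=> /ltn_eqF ->; apply/esym/negP => /eqP vE.
  move: xv => /hasP[i]; rewrite mem_iota add0n => /andP[_ ni].
  have -> : nth false v i = flip n x i.
    by rewrite vE; apply: extend_proj_level; rewrite ltnS ltnW.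
  by rewrite /flip ltn_eqF// eqxx.
have -> : ((n + (if x n != nth false v n then 0 else 1))%N == n) = (x n != nth false v n).
  by case: ifP => _; rewrite ?addn0 ?eqxx// addn1 gtn_eqF.
have {}xv i : (i < n)%N -> nth false v i = x i.
  by move=> ni; apply/esym/eqP/negPn/xv; rewrite mem_iota.
apply/idP/eqP => [xn|vE].
  apply: eq_from_tnth => i; rewrite tnth_mktuple (tnth_nth false) /flip.
  case: eqP => [->|/eqP iN]; first by move: xn; case: (x n); case: (nth _ _ _).
  by apply: xv; rewrite ltn_neqAle iN/= -ltnS ltn_ord.
have -> : nth false v n = flip n x n by rewrite vE; exact: extend_proj_level.
by rewrite /flip eqxx; case: (x n).
Qed.

Section odd_functions.
Variables (R : realType) (n : nat) (f : cantor_space -> R).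

Definition odd_at : Prop :=
  depends_on n.+1 f /\ forall x, f (flip n x) = - f x.

Hypothesis oddf : odd_at.

Lemma odd_flip_word (w : n.+1.-tuple bool) : f (extend (flip_word w)) = - f (extend w).
Proof.
by case: oddf => nf fN; rewrite /flip_word depends_onE// fN.
Qed.

(** Reindexing by the involution [flip_word] preserves [p] and changes every sign, so the sum equals
    its opposite. *)
Lemma sum_odd_at (p : pred (n.+1.-tuple bool)) :
  (forall w, p (flip_word w) = p w) -> \sum_(w | p w) f (extend w) = 0.
Proof.
move=> pE; set S := \sum_(w | _) _.
suff : S = - S by lra.
rewrite {1}/S (reindex_inj (inv_inj (@flip_wordK n))).
by rewrite -sumrN; apply: eq_big => // w _; rewrite odd_flip_word.
Qed.

Definition rate (gamma theta : R) : R :=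
  gamma * (2 * theta ^+ n.+1 + \sum_(1 <= k < n.+1) theta ^+ k).

(** At the top level the average is [- f x], and subtracting [f x] gives [- 2 * f x]; at each lower
    level the average vanishes and only [- f x] remains. This is why [rate] doubles only the highest
    power. *)
Lemma cylindric_operator_odd (gamma theta : R) :
  cylindric_operator gamma theta (fun w : n.+1.-tuple bool => f (extend w)) =
  fun x => - rate gamma theta * f x.
Proof.
case: (oddf) => nf fN; apply/funext => x.
rewrite /cylindric_operator depends_onE// big_nat_recr//=.
have -> : level_average n.+1 (fun w : n.+1.-tuple bool => f (extend w)) x = - f x.
  rewrite /level_average subnn expr0 invr1 mul1r.
  rewrite (big_pred1 (proj_level n.+1 (flip n x))) ?depends_onE ?fN// => v.
  exact: first_difference_last.
rewrite (eq_big_nat _ _ (F2 := fun k => - f x * theta ^+ k)) => [|k /andP[k1 kn]].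
  by rewrite -big_distrr/= /rate; lra.
rewrite /level_average sum_odd_at ?mulr0 ?sub0r 1?mulrC// => w.
apply: first_difference_prefix => // i ni.
by rewrite nth_flip_word ?ltn_eqF// ltnS ltnW.
Qed.

Lemma generator_odd (gamma theta : R) (P : R -> cantor_space -> probability cantor_space R) :
  generator P = closure (pregenerator gamma theta) ->
  {uniform, (fun (t : R) x => t^-1 * (semigroup P t f x - f x)) @ 0^'+
    --> ((fun x => - rate gamma theta * f x) : cantor_space -> R)}.
Proof.
move=> PE.
pose fg : {uniform cantor_space -> R} * {uniform cantor_space -> R} :=
  (f, fun x => - rate gamma theta * f x).
suff : generator P fg by case.
rewrite PE; apply: subset_closure; exists n.+1, (fun w => f (extend w)); split=> //=.
  by apply/funext => x; rewrite depends_onE//; case: oddf.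
by rewrite cylindric_operator_odd.
Qed.

End odd_functions.

(** * Exponential decay of eigenfunctions *)

Section exponential_decay.
Variables (R : realType) (P : R -> cantor_space -> probability cantor_space R).
Hypothesis fellerP : feller_transition_function P.

Lemma semigroupD n (f : cantor_space -> R) (s t : R) x : 0 <= s -> 0 <= t ->
  depends_on n f -> semigroup P (s + t) f x = \int[P s x]_y semigroup P t f y.
Proof.
move=> s0 t0; apply: Rintegral_mixture => B mB.
  exact: (measurable_transition fellerP).
exact: (chapman_kolmogorov fellerP).
Qed.

Lemma semigroup0 n (f : cantor_space -> R) x : depends_on n f -> semigroup P 0 f x = f x.
Proof.
move=> nf; rewrite /semigroup /Rintegral (eq_measure_integral (dirac x)) => [|B mB _].
  rewrite integral_dirac ?diracT ?mul1e//.
  by apply/measurable_EFinP; exact: measurable_fun_depends_on nf.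
exact: (transition0 fellerP).
Qed.

Lemma measurable_semigroup n (f : cantor_space -> R) t : 0 <= t ->
  depends_on n f -> measurable_fun setT (semigroup P t f).
Proof. by move=> t0; apply: measurable_Rintegral => B; exact: (measurable_transition fellerP). Qed.

(** Both sides come from [1 + y <= expR y]. Taking [y = - x] bounds the exponential below; taking
    [y = x] bounds it above by [1 / (1 + x)], which is at most [1 - x + x ^+ 2] because
    [(1 - x + x ^+ 2) * (1 + x) = 1 + x ^+ 3]. *)
Lemma expRN_taylor (x : R) : 0 <= x -> `|1 - x - expR (- x)| <= x ^+ 2.
Proof.
move=> x0; have e1 : 1 + x <= expR x by exact: expR_ge1Dx.
have e2 : 1 - x <= expR (- x) by exact: expR_ge1Dx.
have e3 : expR (- x) <= 1 - x + x ^+ 2.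
  rewrite expRN -[leLHS]mul1r ler_pdivrMr ?expR_gt0//.
  apply: (@le_trans _ _ ((1 - x + x ^+ 2) * (1 + x))).
    rewrite (_ : _ * _ = 1 + x ^+ 3); last by ring.
    by rewrite lerDl exprn_ge0.
  by rewrite ler_wpM2l//; nra.
by rewrite ler_norml; apply/andP; split; nra.
Qed.

(** Both terms are compared with [f x - c * h * f x]: the first by the uniform generator limit, the
    second by [expRN_taylor]. Each comparison uses up half of [h * eps]. *)
Lemma semigroup_near_exp n (f : cantor_space -> R) (c eps : R) : 0 <= c -> 0 < eps ->
  depends_on n f ->
  {uniform, (fun (t : R) x => t^-1 * (semigroup P t f x - f x)) @ 0^'+
    --> ((fun x => - c * f x) : cantor_space -> R)} ->
  \forall h \near 0^'+, forall x,
    `|semigroup P h f x - expR (- (c * h)) * f x| <= h * eps.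
Proof.
move=> c0 eps0 nf lim; have [M fM] := bounded_depends_on nf.
have M0 : 0 <= M by apply: le_trans (fM point).
have e20 : 0 < eps / 2 by rewrite divr_gt0.
have near1 : \forall h \near 0^'+, forall x : cantor_space,
    `|- c * f x - h^-1 * (semigroup P h f x - f x)| < eps / 2.
  apply: (lim [set g : cantor_space -> R | forall x, `|- c * f x - g x| < eps / 2]).
  apply/uniform_nbhs; exists [set xy | `|xy.1 - xy.2| < eps / 2]; split.
    by rewrite -entourage_ballE; exists (eps / 2).
  by move=> g /= H x; exact: H.
(* Adding 1 keeps the divisor positive even if [c] or [M] is zero. *)
have C0 : 0 < c ^+ 2 * M + 1 by rewrite ltr_wpDl// mulr_ge0// sqr_ge0.
near=> h.
have h0 : 0 < h by near: h; exact: nbhs_right_gt.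
have h1 : h * (c ^+ 2 * M) <= eps / 2.
  have : h < eps / 2 / (c ^+ 2 * M + 1).
    by near: h; apply: nbhs_right_lt; rewrite divr_gt0.
  by rewrite ltr_pdivlMr// => /ltW; apply: le_trans; rewrite ler_wpM2l ?(ltW h0)// lerDl.
have H1 : forall x : cantor_space,
    `|- c * f x - h^-1 * (semigroup P h f x - f x)| < eps / 2 by near: h.
move=> x.
have H2 : `|semigroup P h f x - f x + h * c * f x| <= h * (eps / 2).
  rewrite (_ : _ + _ = - (h * (- c * f x - h^-1 * (semigroup P h f x - f x)))); last first.
    by rewrite mulrBr mulVKf ?gt_eqF//; ring.
  by rewrite normrN normrM (gtr0_norm h0) ler_wpM2l// ?ltW// H1.
rewrite (_ : _ - _ = (semigroup P h f x - f x + h * c * f x) +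
    (1 - c * h - expR (- (c * h))) * f x); last by ring.
rewrite (le_trans (ler_normD _ _))// (splitr eps) mulrDr lerD// normrM.
apply: (@le_trans _ _ ((c * h) ^+ 2 * M)).
  by rewrite ler_pM// expRN_taylor// mulr_ge0// ltW.
rewrite (_ : _ * M = h * (h * (c ^+ 2 * M))); last by ring.
by rewrite ler_wpM2l// ltW.
Unshelve. all: by end_near. Qed.

(* P_(Nh) f - e^(-cNh) f telescopes into N terms, each of size at most d because P is a
   contraction; with d = o(h) this replaces solving the differential equation. *)
Lemma semigroup_iter n (f : cantor_space -> R) (c h d : R) N : 0 <= c -> 0 <= h ->
  depends_on n f ->
  (forall x, `|semigroup P h f x - expR (- (c * h)) * f x| <= d) ->
  forall x, `|semigroup P (N%:R * h) f x - expR (- (c * (N%:R * h))) * f x| <= N%:R * d.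
Proof.
move=> c0 h0 nf H; elim: N => [|N IH] x.
  by rewrite !mul0r mulr0 oppr0 expR0 mul1r (semigroup0 _ nf) subrr normr0.
have Nh0 : 0 <= N%:R * h by rewrite mulr_ge0.
have mPh := measurable_semigroup h0 nf.
have intf := integrable_depends_on (P (N%:R * h) x) nf.
have int1 : (P (N%:R * h) x).-integrable setT (EFin \o (fun y => expR (- (c * h)) * f y)).
  by apply: (@integrable_depends_on _ _ n) => y z yz; rewrite (nf _ _ yz).
have int2 : (P (N%:R * h) x).-integrable setT (EFin \o semigroup P h f).
  have [M fM] := bounded_depends_on nf.
  apply: (@integrable_bounded _ _ _ M) => // y.
  by apply: le_normr_Rintegral_probability => //; exact: measurable_fun_depends_on nf.
rewrite -natr1 !mulrDl !mul1r (semigroupD _ _ _ nf)//.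
rewrite mulrDr opprD expRD.
rewrite (_ : _ - _ = \int[P (N%:R * h) x]_y (semigroup P h f y - expR (- (c * h)) * f y) +
    expR (- (c * h)) * (semigroup P (N%:R * h) f x - expR (- (c * (N%:R * h))) * f x)).
  rewrite addrC (le_trans (ler_normD _ _))// lerD//.
    rewrite normrM -[leRHS]mul1r ler_pM// ger0_norm ?expR_ge0//.
    by rewrite -expR0 ler_expR oppr_le0 mulr_ge0.
  apply: le_normr_Rintegral_probability => //.
  apply: measurable_funB => //; apply: measurable_funM => //.
  exact: measurable_fun_depends_on nf.
by rewrite RintegralB// RintegralZl// /semigroup; ring.
Qed.

(** The interval from 0 to [t] is cut into [N] steps of length [t / N]; each costs
    [t / N * (e / t)], so the total error is [e], which is arbitrary. *)
Lemma semigroup_exp n (f : cantor_space -> R) (c t : R) : 0 <= c -> 0 <= t ->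
  depends_on n f ->
  {uniform, (fun (t : R) x => t^-1 * (semigroup P t f x - f x)) @ 0^'+
    --> ((fun x => - c * f x) : cantor_space -> R)} ->
  forall x, semigroup P t f x = expR (- (c * t)) * f x.
Proof.
move=> c0; rewrite le_eqVlt => /predU1P[<-|t0] nf lim x.
  by rewrite mulr0 oppr0 expR0 mul1r (semigroup0 _ nf).
apply/eqP; rewrite -subr_eq0 -normr_le0; apply/ler_addgt0Pl => e e0; rewrite addr0.
have et0 : 0 < e / t by rewrite divr_gt0.
have [r /= r0 Hr] := semigroup_near_exp c0 et0 nf lim.
(* The successor makes [N] nonzero and exceed [t / r], so the step [t / N] is strictly inside the
   radius [r] of the one-step estimate. *)
pose N := (Num.truncn (t / r)).+1.
have tN : N%:R * (t / N%:R) = t by rewrite mulrCA divff ?mulr1// pnatr_eq0.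
have h0 : 0 < t / N%:R by rewrite divr_gt0.
have hr : t / N%:R < r.
  by rewrite ltr_pdivrMr// mulrC -ltr_pdivrMr// truncnS_gt.
have := semigroup_iter N c0 (ltW h0) nf (Hr (t / N%:R) _ h0) x.
rewrite tN mulrA tN mulrCA divff ?gt_eqF// mulr1; apply.
by rewrite /ball_ /= sub0r normrN (gtr0_norm h0).
Qed.

End exponential_decay.

(** * Conditional probabilities given the first coordinates *)

Section rates.
Variables (R : realType) (gamma theta : R).
Hypotheses (gamma_gt0 : 0 < gamma) (theta_gt0 : 0 < theta).

(** For [n = 0] the sum is empty and [2 * theta] suffices; otherwise the term [k = 1] of the sum
    already supplies [theta]. *)
Lemma rate_ge n : gamma * theta <= rate n gamma theta.
Proof.
rewrite /rate ler_pM2l//; case: n => [|n].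
  by rewrite big_geq// addr0 expr1 mulr_natl mulr2n lerDl ltW.
rewrite big_ltn// expr1 addrCA lerDl addr_ge0//.
  by rewrite mulr_ge0// exprn_ge0// ltW.
by apply: sumr_ge0 => k _; rewrite exprn_ge0// ltW.
Qed.

Lemma rate_ge0 n : 0 <= rate n gamma theta.
Proof. by apply: le_trans (rate_ge n); rewrite mulr_ge0// ltW. Qed.

Lemma rateS n : rate n.+1 gamma theta - rate n gamma theta =
  gamma * theta ^+ n.+1 * (2 * theta - 1).
Proof. by rewrite /rate big_nat_recr//= (exprS _ n.+1); ring. Qed.

Lemma rate_monotone :
  (forall n, rate n gamma theta <= rate n.+1 gamma theta) \/
  (forall n, rate n.+1 gamma theta <= rate n gamma theta).
Proof.
have gt n : 0 <= gamma * theta ^+ n.+1 by rewrite mulr_ge0 ?exprn_ge0// ltW.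
have [le0|lt0] := leP 0 (2 * theta - 1); [left|right] => n.
  by rewrite -subr_ge0 rateS mulr_ge0.
by rewrite -subr_le0 rateS mulr_ge0_le0// ltW.
Qed.

End rates.

(** * Abel summation with monotone weights *)

Section summation_by_parts.
Variables (R : realType) (e a : nat -> R).
Hypothesis a01 : forall k, 0 <= a k <= 1.
Hypothesis e0 : forall k, 0 <= e k.

Let S n := \sum_(k < n) e k * (a k.+1 - a k).

(** By Abel's formula the middle term is [- e 0 * a 0] minus the sum of [(e k - e k.-1) * a k] over
    [1 <= k <= n]. Those differences are nonnegative and add up to [e n - e 0]. *)
Lemma sum_by_parts_nondecreasing n : (forall k, e k <= e k.+1) ->
  - e n <= S n.+1 - e n * a n.+1 <= 0.
Proof.
move=> le_e; elim: n => [|n IH].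
  by rewrite /S big_ord1; have := a01 0; have := e0 0; nra.
have -> : S n.+2 = S n.+1 + e n.+1 * (a n.+2 - a n.+1) by rewrite /S big_ord_recr.
by have := a01 n.+1; have := le_e n; nra.
Qed.

(** In the same formula the differences of [e] are now nonpositive: the boundary term lies between
    [- e 0] and 0, the rest between 0 and [e 0 - e n]. *)
Lemma sum_by_parts_nonincreasing n : (forall k, e k.+1 <= e k) ->
  - e 0 <= S n.+1 - e n * a n.+1 <= e 0 - e n.
Proof.
move=> le_e; elim: n => [|n IH].
  by rewrite /S big_ord1; have := a01 0; have := e0 0; nra.
have -> : S n.+2 = S n.+1 + e n.+1 * (a n.+2 - a n.+1) by rewrite /S big_ord_recr.
by have := a01 n.+1; have := le_e n; nra.
Qed.

(** The bound does not grow with [n], although the increments of [a] may add up to order [n] in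
    absolute value: the variation is charged to the monotone weights instead. *)
Lemma sum_by_parts_bound c n : (forall k, e k <= c) ->
  (forall k, e k <= e k.+1) \/ (forall k, e k.+1 <= e k) ->
  `|\sum_(k < n) e k * (a k.+1 - a k)| <= c.
Proof.
move=> ec me; rewrite -/(S n); case: n => [|n].
  by rewrite /S big_ord0 normr0 (le_trans (e0 0)).
have := a01 n.+1; have := ec n; have := ec 0; have := e0 n.
rewrite ler_norml; case: me => me.
  by have := sum_by_parts_nondecreasing n me; nra.
by have := sum_by_parts_nonincreasing n me; nra.
Qed.

End summation_by_parts.

(** * The martingale of conditional probabilities under fair coins *)

Section conditional_probability.
Variable R : realType.
Local Notation b := (bernoulli_measure R).
Implicit Types (x y : cantor_space) (B : set cantor_space).

(** These are the sets [cylinder], indexed by a point rather than a word, so that conditioning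
    yields a function of [x]. *)
Definition ball_prefix (m : nat) (x : cantor_space) : set cantor_space :=
  [set y | forall i, (i < m)%N -> y i = x i].

Lemma measurable_ball_prefix m x : measurable (ball_prefix m x).
Proof.
apply: (@measurable_depends_on m) => y z yz; apply/propext.
by split=> H i im; rewrite -H// yz.
Qed.

Lemma bernoulli_ball_prefix m x : b (ball_prefix m x) = (2 ^- m)%:E.
Proof.
have -> : ball_prefix m x = [set y : cantor_space | forall i : 'I_m, [set x i] (y i)].
  by apply/seteqP; split => y /= H i; [exact: H|move=> im; exact: (H (Ordinal im))].
apply: (etrans (bernoulli_measureP _ (fun i : 'I_m => [set x i]))).
rewrite (eq_bigr (fun=> (2^-1)%:E)) => [|i _]; last first.
  rewrite half_bernoulliE (bigD1 (x i))//= mem_set// big1 ?addr0// => c cx.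
  by rewrite memNset// => /= ce; rewrite ce eqxx in cx.
by rewrite prodEFin prodr_const card_ord exprVn.
Qed.

Definition conditional (B : set cantor_space) (m : nat) (x : cantor_space) : R :=
  2 ^+ m * fine (b (B `&` ball_prefix m x)).

Lemma depends_on_conditional B m : depends_on m (conditional B m).
Proof.
move=> x y xy; rewrite /conditional (_ : ball_prefix m x = ball_prefix m y)//.
by apply/seteqP; split => z H i im; rewrite H// xy.
Qed.

(** Coordinate [m] splits the prefix ball into two halves of equal mass, centred at [x] and
    [flip m x]. This is the martingale property. *)
Lemma conditional_flip B m x : measurable B ->
  conditional B m x = (conditional B m.+1 x + conditional B m.+1 (flip m x)) / 2.
Proof.
move=> mB; rewrite /conditional.
have -> : B `&` ball_prefix m x =
    (B `&` ball_prefix m.+1 x) `|` (B `&` ball_prefix m.+1 (flip m x)).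
  rewrite -setIUr; congr (_ `&` _); apply/seteqP; split => y; last first.
    move=> [H|H] i im; first by apply: H; rewrite ltnS ltnW.
    by rewrite H ?ltnS 1?ltnW// /flip ltn_eqF.
  move=> H; have [yx|yx] := eqVneq (y m) (x m); [left|right] => i.
    by rewrite ltnS leq_eqVlt => /predU1P[->//|]; exact: H.
  rewrite ltnS leq_eqVlt /flip => /predU1P[->|im].
    by rewrite eqxx; move: yx; case: (y m); case: (x m).
  by rewrite ltn_eqF// H.
rewrite measureU; first 1 last.
- by apply: measurableI => //; exact: measurable_ball_prefix.
- by apply: measurableI => //; exact: measurable_ball_prefix.
- apply/seteqP; split => // y [[_ /(_ m (leqnn _)) y1] [_ /(_ m (leqnn _))]].
  by rewrite /flip eqxx y1; case: (x m).
rewrite fineD ?fin_num_measure//; first 1 last.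
- by apply: measurableI => //; exact: measurable_ball_prefix.
- by apply: measurableI => //; exact: measurable_ball_prefix.
by rewrite exprS; field.
Qed.

(** By [conditional_flip] the increment is half the difference between the values of
    [conditional R B m.+1] at [x] and at [flip m x]. *)
Lemma odd_conditional B m : measurable B ->
  odd_at m (fun x => conditional B m.+1 x - conditional B m x).
Proof.
move=> mB; split=> [x y xy|x].
  rewrite (@depends_on_conditional B m.+1 x y xy).
  by rewrite (depends_on_le (leqnSn m) (@depends_on_conditional B m) xy).
have -> : conditional B m (flip m x) = conditional B m x.
  by apply: depends_on_conditional => i im; rewrite /flip ltn_eqF.
by rewrite (@conditional_flip B m x mB); field.
Qed.

Lemma conditional0 B x : conditional B 0 x = fine (b B).
Proof.
rewrite /conditional expr0 mul1r (_ : _ `&` _ = B)//.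
by apply/seteqP; split => [y []|y By].
Qed.

(** A prefix ball of length [n] is contained in [B] or disjoint from it. The martingale thus reaches
    the indicator after [n] steps, and its telescoping expansion is finite. *)
Lemma conditional_depends_on B n : depends_on n B ->
  conditional B n = \1_B.
Proof.
move=> nB; apply/funext => x; rewrite /conditional indicE.
have [/set_mem Bx|/negP Bx] := boolP (x \in B).
  rewrite (_ : _ `&` _ = ball_prefix n x).
    by rewrite bernoulli_ball_prefix/= mulfV// expf_neq0.
  by apply/seteqP; split => [y []//|y H]; split => //; rewrite (nB y x).
rewrite (_ : _ `&` _ = set0) ?measure0 ?mulr0//.
by apply/seteqP; split => // y [By H]; apply: Bx; apply/mem_set; rewrite -(nB y x).
Qed.

Lemma conditional_itv B m x : measurable B -> 0 <= conditional B m x <= 1.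
Proof.
move=> mB; have mBx := measurableI _ _ mB (measurable_ball_prefix m x).
apply/andP; split; first by rewrite mulr_ge0 ?exprn_ge0 ?fine_ge0.
rewrite -[leRHS](@mulfV _ (2 ^+ m)) ?expf_neq0// ler_pM2l ?exprn_gt0//.
rewrite -lee_fin fineK ?fin_num_measure// -(bernoulli_ball_prefix m x).
by apply: le_measure; rewrite ?inE//; exact: measurable_ball_prefix.
Qed.

End conditional_probability.

(** * Approximation of Borel sets and total variation *)

Lemma subset_setYU T (A B A' B' : set T) :
  (A `|` A') `+` (B `|` B') `<=` (A `+` B) `|` (A' `+` B').
Proof.
move=> x /= [[Ax Bx]|[Bx Ax]].
  by case: Ax => [Ax|A'x]; [left; left|right; left]; split => // ?; apply: Bx; [left|right].
by case: Bx => [Bx|B'x]; [left; right|right; right]; split => // ?; apply: Ax; [left|right].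
Qed.

Section density.
Variables (R : realType) (mu : {measure set cantor_space -> \bar R}).
Hypothesis mu_fin : (mu setT < +oo)%E.
Local Open Scope ereal_scope.

Definition approximable (B : set cantor_space) : Prop :=
  forall e : R, (0 < e)%R -> exists n A, depends_on n A /\ mu (B `+` A) < e%:E.

Lemma measurable_setY (A B : set cantor_space) : measurable A -> measurable B ->
  measurable (A `+` B).
Proof. by move=> mA mB; apply: measurableU; exact: measurableD. Qed.

Lemma approximableU B B' : measurable B -> measurable B' ->
  approximable B -> approximable B' -> approximable (B `|` B').
Proof.
move=> mB mB' aB aB' e e0; have e20 : (0 < e / 2)%R by rewrite divr_gt0.
have [n [A [nA BA]]] := aB _ e20; have [n' [A' [nA' BA']]] := aB' _ e20.
have mA := measurable_depends_on nA; have mA' := measurable_depends_on nA'.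
have mBA := measurable_setY mB mA; have mBA' := measurable_setY mB' mA'.
exists (maxn n n'), (A `|` A'); split.
  move=> x y xy; rewrite /setU/= (depends_on_le (leq_maxl n n') nA xy).
  by rewrite (depends_on_le (leq_maxr n n') nA' xy).
apply: le_lt_trans (le_measure _ _ _ (@subset_setYU _ B A B' A')) _.
- by rewrite inE; apply: measurable_setY; exact: measurableU.
- by rewrite inE; exact: measurableU.
by rewrite (le_lt_trans (measureU2 _ _ _))// (splitr e) EFinD lteD.
Qed.

(** Dynkin induction from cylindric sets. A disjoint union is first truncated to finitely many
    pieces, then the truncation is approximated, each at cost [e / 2]. *)
Lemma approximable_measurable B : measurable B -> approximable B.
Proof.
have mlevel A : (exists n, depends_on n A) -> approximable A.
  by move=> [n nA] e e0; exists n, A; split=> //; rewrite setYK measure0 lte_fin.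
rewrite measurable_cantorE; apply: dynkin_induction.
- exact: measurable_cantorE.
- exact: setI_closed_depends_on.
- by apply: mlevel; exists 0%N.
- exact: mlevel.
- move=> S mS aS e e0; have [n [A [nA SA]]] := aS e e0.
  exists n, (~` A); split; first by move=> x y xy; rewrite /setC/= (nA x y xy).
  by rewrite -!setYTC -setYA (setYC A) (setYA setT) setYK set0Y.
- move=> F mF tF aF e e0; have e20 : (0 < e / 2)%R by rewrite divr_gt0.
  pose U N := \bigcup_(k < N) F k; pose S := \bigcup_k F k.
  have mU N : measurable (U N) by exact: fin_bigcup_measurable.
  have mS : measurable S by exact: bigcup_measurable.
  have aU N : approximable (U N).
    elim: N => [|N IH]; first by apply: mlevel; exists 0%N; rewrite /U bigcup0.
    rewrite (_ : U N.+1 = U N `|` F N); first exact: approximableU.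
    apply/seteqP; split => [x [k /= + Fx]|x [[k /= kN Fx]|Fx]].
    - by rewrite ltnS leq_eqVlt => /predU1P[kN|kN]; [right; rewrite -kN|left; exists k].
    - by exists k => //=; rewrite ltnS ltnW.
    - by exists N => /=.
  have tail0 : \bigcap_N (S `\` U N) = set0.
    apply/seteqP; split => // x H; have [[k _ Fx] _] := H 0%N I.
    by have [_] := H k.+1 I; apply; exists k => /=.
  (* Continuity from above, valid because [mu] is finite, makes the mass of the tails vanish. *)
  have : mu \o (fun N => S `\` U N) @ \oo --> mu (\bigcap_N (S `\` U N)).
    apply: nonincreasing_cvg_mu.
    - by apply: le_lt_trans mu_fin; apply: le_measure; rewrite ?inE//; exact: measurableD.
    - by move=> N; exact: measurableD.
    - by rewrite tail0.
    - move=> m n mn; apply/subsetPset => x [Sx nU]; split => // -[k /= km Fx].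
      by apply: nU; exists k => //=; exact: leq_trans mn.
  rewrite tail0 measure0 => /(_ [set y | y < (e / 2)%:E]) [].
    by apply: open_ereal_lt'; rewrite lte_fin.
  move=> N _ /(_ N (leqnn N)) /= SU.
  have [n [A [nA UA]]] := aU N _ e20; exists n, A; split => //.
  have mA := measurable_depends_on nA.
  have SE : S = U N `|` (S `\` U N).
    by rewrite setDUK// => x [k _ Fx]; exists k.
  (* The truncated union is matched with [A] and the tail with the empty set. *)
  rewrite -/S SE -(setU0 A).
  apply: le_lt_trans (le_measure _ _ _ (@subset_setYU _ _ _ _ _)) _.
  - rewrite inE; apply: measurable_setY; apply: measurableU => //.
    exact: measurableD.
  - rewrite inE; apply: measurableU; apply: measurable_setY => //.
    exact: measurableD.
  rewrite setY0 (le_lt_trans (measureU2 _ _ _))//; first exact: measurable_setY.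
    exact: measurableD.
  by rewrite (splitr e) EFinD lteD.
Qed.

End density.

(** * From cylindric sets to the total variation norm *)

Lemma fine_setY_le (R : realType) (mu : probability cantor_space R) (A B : set cantor_space) :
  measurable A -> measurable B -> `|fine (mu B) - fine (mu A)| <= fine (mu (B `+` A)).
Proof.
move=> mA mB; have mBA := measurable_setY mB mA; have mAB := measurable_setY mA mB.
have H C D : measurable C -> measurable D -> measurable (C `+` D) ->
    fine (mu C) - fine (mu D) <= fine (mu (C `+` D)).
  move=> mC mD mCD; rewrite lerBlDl -fineD ?fin_num_measure// fine_le//.
  - by rewrite fin_num_measure.
  - by rewrite fin_numD !fin_num_measure.
  - apply: le_trans (measureU2 mu mD mCD); apply: le_measure; rewrite ?inE//.
      exact: measurableU.
    by move=> x Cx; have [Dx|Dx] := pselect (D x); [left|right; left].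
by rewrite ler_norml lerNl opprB {1}setYC !H.
Qed.

(** Approximation is taken with respect to the sum of [mu] and [nu], so that one cylindric set
    serves both and the two errors together stay below [e]. *)
Lemma le_setwise_depends_on (R : realType) (mu nu : probability cantor_space R) (c : R) :
  (forall n A, depends_on n A -> `|fine (mu A) - fine (nu A)| <= c) ->
  forall B, measurable B -> `|fine (mu B) - fine (nu B)| <= c.
Proof.
move=> H B mB; apply/ler_addgt0Pl => e e0.
have fin : (measure_add mu nu setT < +oo)%E.
  by rewrite measure_addE ltey_eq fin_numD !fin_num_measure.
have [n [A [nA BAe]]] := approximable_measurable fin mB e0.
have mA := measurable_depends_on nA; have mBA := measurable_setY mB mA.
have {}BAe : fine (mu (B `+` A)) + fine (nu (B `+` A)) <= e.
  by rewrite -lee_fin EFinD !fineK ?fin_num_measure// -measure_addE ltW.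
have := fine_setY_le mu mA mB; have := fine_setY_le nu mA mB; have := H n A nA.
rewrite !ler_norml => /andP[h1 h2] /andP[h3 h4] /andP[h5 h6].
by apply/andP; split; lra.
Qed.

(** The total variation is the charge of the positive Hahn set minus that of the negative one; each
    is at most [c] in absolute value, whence the factor 2. *)
Lemma le_tv_norm (R : realType) d (T : measurableType d) (mu nu : {finite_measure set T -> \bar R}) (c : R) :
  (forall B, measurable B -> `|fine (mu B) - fine (nu B)| <= c) ->
  (tv_norm (charge_diff mu nu) <= (2 * c)%:E)%E.
Proof.
move=> H; rewrite /tv_norm; set D := projT2 (cid _).
move: (projT1 _) D => A /= D; move: (cid D) => [B AB] /=.
have [[mA _] [mB _] _ _] := AB.
have E C : measurable C -> charge_diff mu nu C = (fine (mu C) - fine (nu C))%:E.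
  move=> mC; transitivity (mu C + (-1)%:E * nu C)%E; first by [].
  by rewrite EFinB !fineK ?fin_num_measure// EFinN mulN1e.
rewrite /charge_variation jordan_posE jordan_negE cjordan_posE cjordan_negE.
rewrite /crestr0 mem_set//= /crestr !setTI !E// -EFinN -EFinD lee_fin.
by have := H A mA; have := H B mB; rewrite !ler_norml => /andP[? ?] /andP[? ?]; lra.
Qed.

(** * Ergodicity *)

Lemma eq0_le_expR (R : realType) (z nu : R) : 0 < nu ->
  (forall t, 0 <= t -> `|z| <= expR (- (nu * t))) -> z = 0.
Proof.
move=> nu0 H; apply/eqP; rewrite -normr_le0; apply/ler_addgt0Pl => e e0; rewrite addr0.
have e10 : 0 < e^-1 by rewrite invr_gt0.
(* At this time the bound is [expR (- e^-1)], which is at most [e] since [expR e^-1 >= 1 + e^-1]. *)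
have t0 : 0 <= nu^-1 * e^-1 by rewrite mulr_ge0 ?invr_ge0 ?ltW.
apply: le_trans (H _ t0) _; rewrite mulVKf ?gt_eqF// expRN -[leRHS]invrK lef_pV2 ?posrE ?expR_gt0//.
by apply: le_trans (expR_ge1Dx _); rewrite lerDr.
Qed.

Section ergodicity.
Variables (R : realType) (gamma theta : R).
Variable P : R -> cantor_space -> probability cantor_space R.
Hypotheses (gamma_gt0 : 0 < gamma) (theta_gt0 : 0 < theta).
Hypothesis fellerP : feller_transition_function P.
Hypothesis generatorP : generator P = closure (pregenerator gamma theta).
Local Notation b := (bernoulli_measure R).
Local Notation rate k := (rate k gamma theta).

Lemma semigroup_odd k f t x : odd_at k f -> 0 <= t ->
  semigroup P t f x = expR (- (rate k * t)) * f x.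
Proof.
move=> oddf t0; have [kf _] := oddf.
apply: (semigroup_exp fellerP _ t0 kf); first exact: rate_ge0.
exact: generator_odd.
Qed.

(** The martingale telescopes from the constant [fine (b B)], and the semigroup multiplies its
    [k]-th increment, which is odd at [k], by the corresponding exponential. *)
Lemma semigroup_conditional B m t x : measurable B -> 0 <= t ->
  semigroup P t (conditional R B m) x = fine (b B) +
    \sum_(k < m) expR (- (rate k * t)) * (conditional R B k.+1 x - conditional R B k x).
Proof.
move=> mB t0; elim: m => [|m IH].
  rewrite big_ord0 addr0 -(@conditional0 R B x) /semigroup.
  rewrite -[RHS](Rintegral_cst_probability (P t x)).
  by apply: eq_Rintegral => y _; rewrite !conditional0.
have oddB := @odd_conditional R B m mB.
rewrite big_ord_recr/= addrA -IH -(semigroup_odd x oddB t0) /semigroup -RintegralD//.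
- by apply: eq_Rintegral => y _; rewrite addrC subrK.
- by apply: (@integrable_depends_on _ _ m); exact: depends_on_conditional.
- by apply: (@integrable_depends_on _ _ m.+1); case: oddB.
Qed.

Lemma transition_depends_on B n t x : depends_on n B -> 0 <= t ->
  fine (P t x B) = fine (b B) +
    \sum_(k < n) expR (- (rate k * t)) * (conditional R B k.+1 x - conditional R B k x).
Proof.
move=> nB t0; have mB := measurable_depends_on nB.
rewrite -semigroup_conditional// conditional_depends_on//.
by rewrite -Rintegral_indic.
Qed.

Lemma transition_bound t x B : 0 <= t -> measurable B ->
  `|fine (P t x B) - fine (b B)| <= expR (- (gamma * theta * t)).
Proof.
move=> t0; apply: le_setwise_depends_on => n A nA.
have mA := measurable_depends_on nA.
rewrite (transition_depends_on x nA t0) addrC addKr.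
(* With [x] and [t] fixed, the summation runs over levels. The point and the set enter only through
   values in the unit interval, which gives uniformity. *)
apply: (@sum_by_parts_bound _ (fun k => expR (- (rate k * t))) (fun k => conditional R A k x)).
- by move=> k; exact: conditional_itv.
- by move=> k; exact: expR_ge0.
- by move=> k; rewrite ler_expR lerN2 ler_wpM2r// rate_ge.
(* The sign in the exponent swaps the two cases: growing rates give decreasing weights. *)
- case: (rate_monotone gamma_gt0 theta_gt0) => H; [right|left] => k;
    by rewrite ler_expR lerN2 ler_wpM2r.
Qed.

(** All words of length [k.+1] have the same mass under [b], so the integral is a multiple of a sum
    that cancels in flipped pairs. *)
Lemma Rintegral_bernoulli_odd k f : odd_at k f -> \int[b]_x f x = 0.
Proof.
move=> oddf; have [kf _] := oddf; rewrite (Rintegral_depends_on _ kf).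
rewrite (eq_bigr (fun w => f (extend w) * 2 ^- k.+1)) => [|w _]; last first.
  congr (_ * _); rewrite (_ : cylinder w = ball_prefix k.+1 (extend w)).
    by rewrite bernoulli_ball_prefix.
  apply/seteqP; split => x /=.
    by move=> xw i ik; rewrite -(extend_proj_level x ik) (xw : proj_level _ _ = w).
  by move/eq_proj_level => xw; rewrite /cylinder/= xw proj_level_extend.
by rewrite -mulr_suml (sum_odd_at oddf) ?mul0r.
Qed.

Lemma measurable_transitionE t B : 0 <= t -> measurable B ->
  measurable_fun setT (P t ^~ B).
Proof. by move=> t0 mB; exact: (measurable_transition fellerP). Qed.

Lemma transition_integralE (mu : probability cantor_space R) t B : 0 <= t -> measurable B ->
  (\int[mu]_x P t x B)%E = (\int[mu]_x fine (P t x B))%:E.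
Proof.
move=> t0 mB; have mP := measurable_transitionE t0 mB.
have E : (\int[mu]_x P t x B)%E = (\int[mu]_x (fine (P t x B))%:E)%E.
  by apply: eq_integral => x _; rewrite fineK ?fin_num_measure.
rewrite E /Rintegral fineK//; apply: integrable_fin_num => //.
apply: (@integrable_bounded _ _ _ 1) => [|x]; first exact: measurableT_comp.
by rewrite ger0_norm ?fine_ge0// -lee_fin fineK ?fin_num_measure ?probability_le1.
Qed.

(** Dynkin induction: on cylindric sets the expansion of the transition probability is integrated
    termwise and only its constant survives. Complements follow from total mass 1, disjoint unions
    from exchanging series and integral. *)
Lemma bernoulli_invariant : invariant_measure P b.
Proof.
move=> t B t0; rewrite measurable_cantorE.
pose G B := (\int[b]_x P t x B)%E = b B.
apply: (@dynkin_induction _ _ _ G measurable_cantorE setI_closed_depends_on).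
- rewrite /G probability_setT -(@probability_setT _ _ _ b) -[RHS]mul1e -integral_cst//.
  by apply: eq_integral => x _; rewrite probability_setT.
- move=> A [n nA]; have mA := measurable_depends_on nA.
  rewrite /G transition_integralE// -[RHS]fineK ?fin_num_measure//; congr (_%:E).
  pose g k x : R := conditional R A k.+1 x - conditional R A k x.
  have ogk k : odd_at k (g k) := @odd_conditional R A k mA.
  have intg k : b.-integrable setT (EFin \o (fun x => expR (- (rate k * t)) * g k x)).
    apply: (@integrable_depends_on _ _ k.+1) => y z yz.
    by case: (ogk k) => kg _; rewrite (kg _ _ yz).
  transitivity (\int[b]_x (fine (b A) + \sum_(k < n) expR (- (rate k * t)) * g k x)).
    by apply: eq_Rintegral => x _; rewrite (transition_depends_on x nA t0).
  rewrite RintegralD//; last 2 first.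
  + exact: finite_measure_integrable_cst.
  + rewrite (_ : EFin \o _ = fun x => (\sum_(k < n) (expR (- (rate k * t)) * g k x)%:E)%E).
      by apply: (integrable_sum measurableT) => k _; exact: intg.
    by apply/funext => x /=; rewrite sumEFin.
  rewrite Rintegral_cst_probability Rintegral_sum_probability//.
  rewrite big1 ?addr0// => k _; rewrite RintegralZl ?(Rintegral_bernoulli_odd (ogk k)) ?mulr0//.
  by apply: (@integrable_depends_on _ _ k.+1); case: (ogk k).
- move=> S mS GS; have mSC := measurableC mS.
  have : (\int[b]_x (P t x S + P t x (~` S)) = b setT)%E.
    rewrite -[RHS]mul1e -integral_cst//; apply: eq_integral => x _.
    by rewrite probability_setC// addeC subeK ?fin_num_measure.
  have mPS := measurable_transitionE t0 mS; have mPSC := measurable_transitionE t0 mSC.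
  rewrite ge0_integralD//.
  rewrite /G GS probability_setT probability_setC// => <-.
  by rewrite addeC addeK// fin_num_measure.
- move=> F mF tF GF; rewrite /G.
  have mUF : measurable (\bigcup_k F k) by exact: bigcup_measurable.
  under eq_integral do rewrite measure_semi_bigcup//.
  rewrite measure_semi_bigcup//.
  rewrite integral_nneseries//; last by move=> k; exact: measurable_transitionE.
  by apply: eq_eseriesr => k _; exact: GF.
Qed.

(** Invariance writes [m B - b B] as the [m]-average of [P t x B - b B], which is exponentially
    small uniformly in [x]; since [t] is arbitrary, the difference is zero. *)
Lemma invariant_unique (m : probability cantor_space R) : invariant_measure P m ->
  forall B, measurable B -> m B = b B.
Proof.
move=> mP B mB; rewrite -[LHS]fineK ?fin_num_measure// -[RHS]fineK ?fin_num_measure//.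
congr (_%:E); apply/eqP; rewrite -subr_eq0; apply/eqP.
apply: (@eq0_le_expR _ _ (gamma * theta)) => [|t t0]; first by rewrite mulr_gt0.
have mPt := measurable_transitionE t0 mB.
have int1 : m.-integrable setT (EFin \o (fun x => fine (P t x B))).
  apply: (@integrable_bounded _ _ _ 1) => [|x]; first exact: measurableT_comp.
  by rewrite ger0_norm ?fine_ge0// -lee_fin fineK ?fin_num_measure ?probability_le1.
rewrite -(mP t B t0 mB) transition_integralE//=.
rewrite (_ : _ - _ = \int[m]_x (fine (P t x B) - fine (b B))).
  apply: le_normr_Rintegral_probability => [|x]; last exact: transition_bound.
  by apply: measurable_funB => //; exact: measurableT_comp.
rewrite RintegralB//; last exact: finite_measure_integrable_cst.
by rewrite Rintegral_cst_probability.
Qed.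

End ergodicity.

Theorem theorem5 (R : realType) (gamma theta : R)
    (d : measure_display) (W : measurableType d)
    (Pr : cantor_space -> probability W R) (X : R -> W -> cantor_space)
    (P : R -> cantor_space -> probability cantor_space R)
    (gamma_gt0 : 0 < gamma) (theta_gt0 : 0 < theta)
    (PSSS : SSS gamma theta Pr X P) :
  (invariant_measure P (bernoulli_measure R) /\
   (forall m : probability cantor_space R, invariant_measure P m ->
      forall B : set cantor_space, measurable B -> m B = bernoulli_measure R B)) /\
  (exists K nu : R, [/\ 0 < K, 0 < nu &
     forall (x : cantor_space) (t : R), 0 <= t ->
       (tv_norm (charge_diff (P t x) (bernoulli_measure R))
          <= (K * expR (- (nu * t)))%:E)%E]).
Proof.
have fellerP := SSS_feller PSSS; have genP := SSS_generator PSSS.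
split; [split|].
- exact: (bernoulli_invariant gamma_gt0 theta_gt0 fellerP genP).
- exact: (invariant_unique gamma_gt0 theta_gt0 fellerP genP).
(* The rate is that of the setwise bound; the constant 2 comes from [le_tv_norm]. *)
exists 2, (gamma * theta); split => //; first by rewrite mulr_gt0.
move=> x t t0; apply: le_tv_norm => B mB.
exact: (transition_bound gamma_gt0 theta_gt0 fellerP genP).
Qed.
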